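(* Let $(A,P)$ be a Rota-Baxter (associative) algebra of weight $\lambda\in\mathbf k$ in characteristic $p>0$. Let $[-,-]$ be the commutator of $A$, $(-)^p$ the $p$-th power map of $A$, and $x\rhd_Py:=[P(x),y]=P(x)y-yP(x)$. Then $(A,\lambda[-,-],\lambda^{p-1}(-)^p,\rhd_P)$ is a restricted post-Lie algebra.
   Context: Convention: $\mathbf k$ is an algebraically closed field of prime characteristic $p$; everything is over $\mathbf k$. A Rota-Baxter algebra of weight $\lambda$ is an associative algebra $A$ with a linear map $P:A\to A$ such that $P(x)P(y)=P(P(x)y)+P(xP(y))+\lambda P(xy)$ for all $x,y\in A$. Restricted Lie algebra: a Lie algebra $(\mathfrak g,[-,-])$ with a $p$-map $(-)^{[p]}:\mathfrak g\to\mathfrak g$ satisfying $(ax)^{[p]}=a^px^{[p]}$ for $a\in\mathbf k$, $[x^{[p]},y]=(\mathrm{ad}_x)^p(y)$, and $(x+y)^{[p]}=x^{[p]}+y^{[p]}+\sum_{i=1}^{p-1}s_i(x,y)$, where $i\,s_i(x,y)$ is the coefficient of $t^{i-1}$ in $(\mathrm{ad}_{tx+y})^{p-1}(x)\in\mathbf k[t]\otimes\mathfrak g$. Post-Lie algebra: a Lie algebra $(\mathfrak g,[-,-])$ with a bilinear product $\rhd$ such that $x\rhd[y,z]=[x\rhd y,z]+[y,x\rhd z]$ and $([x,y]+x\rhd y-y\rhd x)\rhd z=x\rhd(y\rhd z)-y\rhd(x\rhd z)$. For a composition $\alpha=(\alpha_1,\dots,\alpha_r)\vDash n$ (a tuple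 of positive integers with sum $n$, of length $\ell(\alpha)=r$), $C_\alpha=\prod_{k=1}^r\binom{\alpha_1+\cdots+\alpha_k-1}{\alpha_k-1}$. Restricted post-Lie algebra $(\mathfrak g,[-,-],(-)^{[p]},\rhd)$: a post-Lie algebra such that $(\mathfrak g,[-,-],(-)^{[p]})$ is a restricted Lie algebra and, for all $x,y$, $y\rhd x^{[p]}=(\mathrm{ad}_x)^{p-1}(y\rhd x)$ and $x^{\llbracket p\rrbracket}\rhd y=\underbrace{x\rhd(x\rhd\cdots(x}_{p}\rhd y)\cdots)$, where $$x^{\llbracket p\rrbracket}=x^{[p]}+\sum_{r=1}^{p-1}\frac1r\sum_{\alpha\vDash p,\ \ell(\alpha)=r}C_\alpha\,[x^{\rhd\alpha_1},[x^{\rhd\alpha_2},[\cdots[x^{\rhd\alpha_{r-1}},x^{\rhd\alpha_r}]\cdots]]],$$ with $x^{\rhd k}=x\rhd(x\rhd\cdots(x\rhd x)\cdots)$ ($k$ copies of $x$, $x^{\rhd 1}=x$), and $\frac1r$ the inverse of $r$ modulo $p$. *)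

(* Defs.v *)
From HB Require Import structures.
From mathcomp Require Import all_boot all_order all_algebra.

Set Implicit Arguments.
Unset Strict Implicit.
Unset Printing Implicit Defensive.

Import GRing.Theory.
Local Open Scope ring_scope.

Section AssociativeAlgebras.
Variables (k : fieldType) (A : lmodType k) (mul : A -> A -> A).

(* No unit is required, whereas the algType of the library is unital and
   nontrivial; lemma assoc_algebra_algType below relates the two. *)
Definition assoc_algebra : Prop :=
  bilinear_for *:%R *:%R mul /\ associative mul.

Definition commutator (x y : A) : A := mul x y - mul y x.

(* The product of n copies of x, for n > 0; without a unit, n = 0 is
   meaningless, and the value is then x. *)
Definition alg_pow (n : nat) (x : A) : A := iter n.-1 (mul x) x.

Record rota_baxter_algebra (lambda : k) (P : A -> A) : Prop := {
  rba_assoc_algebra : assoc_algebra;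
  rba_linear : linear P;
  rba_identity : forall x y,
    mul (P x) (P y) =
      P (mul (P x) y) + P (mul x (P y)) + lambda *: P (mul x y)
}.

End AssociativeAlgebras.

Section LieAlgebras.
Variables (k : fieldType) (g : lmodType k) (br : g -> g -> g).

Record lie_algebra : Prop := {
  lie_bilinear : bilinear_for *:%R *:%R br;
  lie_alternating : forall x, br x x = 0;
  lie_jacobi : forall x y z,
    br x (br y z) + br y (br z x) + br z (br x y) = 0
}.

(* The element \sum_i u_i t^i of k[t] (x) g is represented by its sequence of
   coefficients u : nat -> g; tpoly_bracket is the k[t]-bilinear extension of
   the bracket of g. *)
Definition tpoly_const (x : g) : nat -> g := fun i => if i is 0 then x else 0.

(* t x + y *)
Definition tpoly_affine (x y : g) : nat -> g :=
  fun i => match i with 0 => y | 1 => x | _ => 0 end.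

Definition tpoly_bracket (u v : nat -> g) : nat -> g :=
  fun n => \sum_(i < n.+1) br (u i) (v (n - i)%N).

(* s_i(x, y) *)
Definition jacobson_s (p i : nat) (x y : g) : g :=
  i%:R^-1 *:
    iter p.-1 (tpoly_bracket (tpoly_affine x y)) (tpoly_const x) i.-1.

Record restricted_lie_algebra (p : nat) (pmap : g -> g) : Prop := {
  rlie_lie : lie_algebra;
  rlie_scale : forall (a : k) x, pmap (a *: x) = a ^+ p *: pmap x;
  rlie_ad : forall x y, br (pmap x) y = iter p (br x) y;
  rlie_add : forall x y,
    pmap (x + y) = pmap x + pmap y + \sum_(1 <= i < p) jacobson_s p i x y
}.

Record post_lie_algebra (tri : g -> g -> g) : Prop := {
  pl_lie : lie_algebra;
  pl_bilinear : bilinear_for *:%R *:%R tri;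
  pl_derivation : forall x y z,
    tri x (br y z) = br (tri x y) z + br y (tri x z);
  pl_action : forall x y z,
    tri (br x y + tri x y - tri y x) z = tri x (tri y z) - tri y (tri x z)
}.

(* Right-nested bracket [x_1, [x_2, [... [x_{r-1}, x_r] ...]]] of a nonempty
   sequence, equal to x_1 when r = 1. *)
Fixpoint nested_bracket (s : seq g) : g :=
  match s with
  | [::] => 0
  | [:: x] => x
  | x :: s' => br x (nested_bracket s')
  end.

End LieAlgebras.

(* The parts of a composition of n are at most n, hence the type 'I_n.+1. *)
Definition compositions (n r : nat) : {set r.-tuple 'I_n.+1} :=
  [set a : r.-tuple 'I_n.+1 |
    [forall i, (0 < tnth a i)%N] && ((\sum_(i < r) tnth a i)%N == n)].

Definition comp_coef (n r : nat) (a : r.-tuple 'I_n.+1) : nat :=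
  (\prod_(i < r)
     'C((\sum_(j < r | (j <= i)%N) tnth a j).-1, (tnth a i).-1))%N.

Section RestrictedPostLieAlgebras.
Variables (k : fieldType) (g : lmodType k).
Variables (p : nat) (br : g -> g -> g) (pmap : g -> g) (tri : g -> g -> g).

(* x |> (x |> ... (x |> x) ...) with n copies of x, for n > 0 *)
Definition tri_pow (n : nat) (x : g) : g := iter n.-1 (tri x) x.

(* x^[[p]] *)
Definition double_pmap (x : g) : g :=
  pmap x + \sum_(1 <= r < p) r%:R^-1 *:
    \sum_(a in compositions p r)
      (comp_coef a)%:R *: nested_bracket br [seq tri_pow (i : 'I_p.+1) x | i <- a].

Record restricted_post_lie_algebra : Prop := {
  rpl_post_lie : post_lie_algebra br tri;
  rpl_restricted : restricted_lie_algebra br p pmap;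
  rpl_tri_pmap : forall x y, tri y (pmap x) = iter p.-1 (br x) (tri y x);
  rpl_pmap_tri : forall x y, tri (double_pmap x) y = iter p (tri x) y
}.

End RestrictedPostLieAlgebras.

Lemma assoc_algebra_algType (k : fieldType) (A : algType k) :
  assoc_algebra (fun x y : A => x * y).
Proof.
split; last exact: mulrA.
split=> u a x y /=; first by rewrite mulrDl scalerAl.
by rewrite mulrDr scalerAr.
Qed.

Lemma alg_pow_algType (k : fieldType) (A : algType k) (n : nat) (x : A) :
  alg_pow (fun x y : A => x * y) n.+1 x = x ^+ n.+1.
Proof. by rewrite /alg_pow /=; elim: n => //= n ->; rewrite [RHS]exprS. Qed.

(* Main.v *)
Require Import Defs.
From HB Require Import structures.
From mathcomp Require Import all_boot all_order all_algebra.

(* Write [a = P x].  Induction on [n] shows that the powers of [x] for the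
   product [y * z = P y z + y P z + lambda y z] are
   [x^{*n} = \sum_i (a + lambda x)^i x a^(n-1-i)], and [P] is multiplicative
   for [*], so [P (x^{*p}) = (P x)^p] acts on [A] by [(ad a)^p].  It remains to
   identify [x^{*p}] with [x^{[[p]]}].  Telescoping [(a + X x)^p - a^p] shows
   that [x^{*p}] has the coefficient of [X^(r+1)] in [(a + X x)^p] as its
   coefficient of [lambda^r]; for [r + 1 < p], differentiating in [X] turns it
   into [1 / (r + 1)] times the coefficient of [X^r] in
   [ad (a + X x)^(p-1) x], which is also Jacobson's formula.  Moving all the
   [ad a] of this expression to the right, onto [x], yields the sum over
   compositions, with coefficients [C_alpha].  As [A] may lack a unit, these
   computations take place in its unitization. *)

Set Implicit Arguments.
Unset Strict Implicit.
Unset Printing Implicit Defensive.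

Import GRing.Theory.
Local Open Scope ring_scope.

Lemma sum_bin_pascal (V : zmodType) (n : nat) (F : nat -> V) :
  \sum_(i < n.+2) F i *+ 'C(n.+1, i) =
  \sum_(i < n.+1) F i *+ 'C(n, i) + \sum_(i < n.+1) F i.+1 *+ 'C(n, i).
Proof.
rewrite big_ord_recl /= bin0 mulr1n.
under eq_bigr do rewrite /bump /= add1n binS mulrnDr.
rewrite big_split /= addrA; congr (_ + _).
by rewrite [RHS]big_ord_recl /= big_ord_recr /= bin_small // mulr0n addr0 bin0.
Qed.

Section Ad.
Variable R : pzRingType.
Implicit Types x y z : R.

Definition ad x y : R := x * y - y * x.

Lemma ad_zmod_morphism x : zmod_morphism (ad x).
Proof.
move=> y z; rewrite /ad mulrBr mulrBl !opprB -!addrA; congr (_ + _).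
by rewrite addrCA [RHS]addrCA; congr (_ + _); rewrite addrC.
Qed.

HB.instance Definition _ x :=
  GRing.isZmodMorphism.Build R R (ad x) (ad_zmod_morphism x).

Lemma ad_derivation x y z : ad x (y * z) = ad x y * z + y * ad x z.
Proof. by rewrite /ad mulrBl mulrBr !mulrA addrA subrK. Qed.

Lemma ad_jacobi x y z : ad x (ad y z) = ad (ad x y) z + ad y (ad x z).
Proof.
rewrite [ad y z]/ad raddfB /= !ad_derivation opprD.
by rewrite [- _ + - (z * _)]addrC addrACA.
Qed.

Lemma adC x y : ad x y = - ad y x.
Proof. by rewrite /ad opprB. Qed.

Lemma adDl x y z : ad (x + y) z = ad x z + ad y z.
Proof. by rewrite /ad mulrDl mulrDr opprD addrACA. Qed.

Lemma adDr x y z : ad x (y + z) = ad x y + ad x z.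
Proof. exact: raddfD. Qed.

Lemma iter_adN x n y : iter n (ad x) (- y) = - iter n (ad x) y.
Proof. by elim: n => //= n ->; rewrite raddfN. Qed.

Lemma telescope_exp x y z n :
  x ^+ n * z - z * y ^+ n =
  \sum_(i < n) x ^+ i * (x * z - z * y) * y ^+ (n - i.+1).
Proof.
elim: n => [|n IHn]; first by rewrite big_ord0 !expr0 mul1r mulr1 subrr.
rewrite big_ord_recr /= subnn expr0 mulr1 exprSr exprSr.
under eq_bigr => i _ do rewrite subSn // exprSr mulrA.
by rewrite -mulr_suml -IHn mulrBl mulrBr !mulrA addrC addrA subrK.
Qed.

Lemma iter_ad_bin x z n :
  iter n (ad x) z = \sum_(i < n.+1) x ^+ (n - i) * z * (- x) ^+ i *+ 'C(n, i).
Proof.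
elim: n => [|n /= ->]; first by rewrite big_ord1 !expr0 mul1r mulr1.
rewrite (sum_bin_pascal n (fun i => x ^+ (n.+1 - i) * z * (- x) ^+ i)).
rewrite /ad -mulrN mulr_sumr mulr_suml; congr (_ + _); apply: eq_bigr => i _.
  by rewrite mulrnAr !mulrA -exprS -subSn // -ltnS.
by rewrite mulrnAl -mulrA -exprSr subSS.
Qed.

End Ad.

Lemma bin_pchar_pred (R : nzRingType) (p : nat) (hp : p \in [pchar R]) i :
  (i < p)%N -> 'C(p.-1, i)%:R = (-1) ^+ i :> R.
Proof.
have p_pr := pcharf_prime hp; have p_gt0 := prime_gt0 p_pr.
elim: i => [|i IHi] ltip; first by rewrite bin0.
have: 'C(p, i.+1)%:R = 0 :> R.
  by apply/eqP; rewrite -(dvdn_pcharf hp) prime_dvd_bin.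
rewrite -[in 'C(p, _)](prednK p_gt0) binS natrD IHi ?(ltnW ltip) // => /eqP.
by rewrite addr_eq0 exprS mulN1r => /eqP.
Qed.

Section AdPchar.
Variables (R : nzRingType) (p : nat) (hp : p \in [pchar R]).

Lemma iter_ad_pchar (x z : R) :
  iter p.-1 (ad x) z = \sum_(i < p) x ^+ i * z * x ^+ (p - i.+1).
Proof.
have p_gt0 := prime_gt0 (pcharf_prime hp).
rewrite iter_ad_bin prednK // [RHS](reindex_inj rev_ord_inj) /=.
apply: eq_bigr => i _; rewrite subnSK // subKn ?(ltnW (ltn_ord i)) //.
rewrite -mulr_natr (bin_pchar_pred hp) // -subn1 subnAC subn1 subnS.
rewrite -[LHS]mulrA exprNn -commr_sign -[x ^+ i * _ * _]mulrA.
by rewrite -expr2 sqrr_sign mulr1.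
Qed.

Lemma ad_exp_pchar (x z : R) : ad (x ^+ p) z = iter p (ad x) z.
Proof.
rewrite -[in RHS](prednK (prime_gt0 (pcharf_prime hp))) iterSr.
by rewrite iter_ad_pchar /ad telescope_exp.
Qed.

End AdPchar.

Section AffinePoly.
Variable R : nzRingType.
Implicit Types (x y : R) (f : {poly R}).

Definition affine x y : {poly R} := x%:P * 'X + y%:P.

Lemma coef_affineM x y f i :
  (affine x y * f)`_i = y * f`_i + (if i is j.+1 then x * f`_j else 0).
Proof.
rewrite mulrDl coefD coefCM addrC -mulrA coefCM coefXM.
by case: i => //=; rewrite mulr0.
Qed.

Lemma coef_Maffine x y f i :
  (f * affine x y)`_i = f`_i * y + (if i is j.+1 then f`_j * x else 0).
Proof.
rewrite mulrDr coefD coefMC addrC mulrA coefMX.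
by case: i => //= i; rewrite coefMC.
Qed.

Lemma coef_ad_affine x y f i :
  (ad (affine x y) f)`_i = ad y f`_i + (if i is j.+1 then ad x f`_j else 0).
Proof.
rewrite coefB coef_affineM coef_Maffine opprD addrACA.
by case: i => //=; rewrite subrr.
Qed.

Lemma coef_exp_affine_gt x y n i : (n < i)%N -> (affine x y ^+ n)`_i = 0.
Proof.
elim: n i => [|n IHn] [|i] // lt_ni; first by rewrite expr0 coef1.
by rewrite exprS coef_affineM !IHn ?mulr0 ?addr0 // ltnW.
Qed.

Lemma coef_exp_affine_top x y n : (affine x y ^+ n)`_n = x ^+ n.
Proof.
elim: n => [|n IHn]; first by rewrite !expr0 coef1.
by rewrite exprS coef_affineM IHn coef_exp_affine_gt // mulr0 add0r -exprS.
Qed.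

Lemma coef0_exp_affine x y n : (affine x y ^+ n)`_0 = y ^+ n.
Proof.
elim: n => [|n IHn]; first by rewrite !expr0 coef1.
by rewrite exprS coef_affineM IHn addr0 exprS.
Qed.

Lemma deriv_exp_affine x y n :
  (affine x y ^+ n)^`() =
  \sum_(i < n) affine x y ^+ i * x%:P * affine x y ^+ (n - i.+1).
Proof.
have dq : (affine x y)^`() = x%:P.
  by rewrite derivD derivC addr0 derivM derivC derivX mul0r add0r mulr1.
elim: n => [|n IHn]; first by rewrite big_ord0 expr0 -polyC1 derivC.
rewrite exprSr derivM IHn dq big_ord_recr /= subnn expr0 mulr1 mulr_suml.
by congr (_ + _); apply: eq_bigr => i _; rewrite -mulrA -exprSr subnSK.
Qed.

(* Differentiating [(x X + y)^p] produces the sum that [iter_ad_pchar]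
   identifies with an iterated commutator. *)
Lemma coef_exp_affine_pchar p (hp : p \in [pchar R]) x y i :
  (affine x y ^+ p)`_i.+1 *+ i.+1 = (iter p.-1 (ad (affine x y)) x%:P)`_i.
Proof.
by rewrite -coef_deriv deriv_exp_affine iter_ad_pchar // pchar_poly.
Qed.

End AffinePoly.

Section AffinePolyAlg.
Variables (k : fieldType) (B : algType k).

Lemma sum_exp_affine (c : k) (x a : B) n :
  \sum_(i < n) (a + c *: x) ^+ i * x * a ^+ (n - i.+1) =
  \sum_(i < n) c ^+ i *: (affine x a ^+ n)`_i.+1.
Proof.
have comm_c (f : {poly B}) : comm_poly f c%:A.
  by rewrite /comm_poly mulr_algl mulr_algr.
pose w : {poly B} := \sum_(i < n) affine x a ^+ i * x%:P * a%:P ^+ (n - i.+1).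
have wE : affine x a ^+ n - a%:P ^+ n = w * 'X.
  have := telescope_exp (affine x a) a%:P 1 n; rewrite !mulr1 !mul1r => ->.
  rewrite mulr_suml; apply: eq_bigr => i _.
  rewrite /affine addrK -!mulrA; congr (_ * (_ * _)).
  by rewrite commr_polyX.
have coefw i : w`_i = (affine x a ^+ n)`_i.+1.
  have := congr1 (fun f : {poly B} => f`_i.+1) wE.
  by rewrite /= coefB coefMX -rmorphXn /= coefC subr0.
have size_w : (size w <= n)%N.
  by apply/leq_sizeP => j le_nj; rewrite coefw coef_exp_affine_gt.
transitivity w.[c%:A].
  rewrite horner_sum; apply: eq_bigr => i _.
  rewrite -rmorphXn /= !hornerM_comm // !hornerC horner_exp_comm //.
  by rewrite /affine hornerD hornerM_comm // hornerX !hornerC mulr_algr addrC.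
rewrite (horner_coef_wide _ size_w); apply: eq_bigr => i _.
by rewrite coefw -[c%:A]/(in_alg B c) -rmorphXn mulr_algr.
Qed.

End AffinePolyAlg.

Section Jacobson.
Variables (k : fieldType) (B : algType k) (p : nat) (hp : p \in [pchar k]).

Lemma pchar_algType : p \in [pchar B].
Proof. exact: rmorph_pchar (in_alg B) _ hp. Qed.

Lemma coef_exp_affine_div (x y : B) i : (0 < i < p)%N ->
  (affine x y ^+ p)`_i = i%:R^-1 *: (iter p.-1 (ad (affine x y)) x%:P)`_i.-1.
Proof.
case: i => // i ltip; rewrite -(coef_exp_affine_pchar pchar_algType).
rewrite -[X in _ *: X]scaler_nat scalerA mulVf ?scale1r //.
by rewrite -(dvdn_pcharf hp) gtnNdvd.
Qed.

Lemma exp_add_pchar (x y : B) :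
  (x + y) ^+ p = x ^+ p + y ^+ p +
    \sum_(1 <= i < p) i%:R^-1 *: (iter p.-1 (ad (affine x y)) x%:P)`_i.-1.
Proof.
have p_gt0 := prime_gt0 (pcharf_prime hp).
have -> : (x + y) ^+ p = (affine x y ^+ p).[1].
  rewrite horner_exp_comm /comm_poly ?mul1r ?mulr1 //.
  by rewrite /affine hornerD hornerMX !hornerC mulr1.
rewrite (@horner_coef_wide _ p.+1); last first.
  by apply/leq_sizeP => j /coef_exp_affine_gt.
under eq_bigr do rewrite expr1n mulr1.
rewrite big_ord_recr /= coef_exp_affine_top addrC -addrA; congr (_ + _).
rewrite -(big_mkord xpredT (fun i => (affine x y ^+ p)`_i)) big_ltn //.
rewrite coef0_exp_affine; congr (_ + _).
by apply: eq_big_nat => i; apply: coef_exp_affine_div.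
Qed.

End Jacobson.

Definition is_comp (n : nat) (s : seq nat) : bool :=
  (0%N \notin s) && (sumn s == n).

Definition seq_comp_coef (s : seq nat) : nat :=
  (\prod_(i < size s) 'C((sumn (take i.+1 s)).-1, (nth 0%N s i).-1))%N.

Lemma seq_comp_coef_rcons s m :
  seq_comp_coef (rcons s m) =
  (seq_comp_coef s * 'C((sumn s + m).-1, m.-1))%N.
Proof.
rewrite /seq_comp_coef size_rcons big_ord_recr /=; congr (_ * _)%N.
  apply: eq_bigr => i _; rewrite nth_rcons ltn_ord.
  by rewrite -cats1 takel_cat.
by rewrite take_oversize ?size_rcons // nth_rcons ltnn eqxx sumn_rcons.
Qed.

Lemma sum_tnth_prefix n r (a : r.-tuple 'I_n) (i : 'I_r) :
  (\sum_(j < r | (j <= i)%N) tnth a j)%N =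
  sumn (take i.+1 [seq val t | t <- a]).
Proof.
rewrite sumnE -map_take big_map (big_nth (tnth a i)) size_takel ?size_tuple //.
rewrite big_mkord (big_ord_widen_cond _ xpredT
  (fun j => nat_of_ord (nth (tnth a i) (take i.+1 a) j)) (ltn_ord i)).
by apply: eq_bigr => j ltji; rewrite nth_take // (tnth_nth (tnth a i)).
Qed.

Lemma comp_coefE n r (a : r.-tuple 'I_n.+1) :
  comp_coef a = seq_comp_coef [seq val i | i <- a].
Proof.
rewrite /seq_comp_coef size_map size_tuple; apply: eq_bigr => i _.
rewrite sum_tnth_prefix (nth_map (tnth a i)) ?size_tuple //.
by rewrite -(tnth_nth (tnth a i)).
Qed.

Lemma mem_compositions n r (a : r.-tuple 'I_n.+1) :
  (a \in compositions n r) = is_comp n [seq val i | i <- a].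
Proof.
rewrite inE /is_comp sumnE big_map big_tuple; congr (_ && _).
apply/forallP/idP => [a_gt0 | a0 i].
  by apply/mapP => -[_ /tnthP[i ->]] /= ai0; move: (a_gt0 i); rewrite -ai0.
rewrite lt0n; apply: contra a0 => /eqP <-.
by apply: map_f; apply: mem_tnth.
Qed.

Lemma is_comp_rcons n s m :
  is_comp n (rcons s m) = [&& (0 < m)%N, (m <= n)%N & is_comp (n - m) s].
Proof.
rewrite /is_comp mem_rcons in_cons negb_or eq_sym -lt0n sumn_rcons -andbA.
case: (0 < m)%N => //=; rewrite [RHS]andbCA; congr (_ && _).
apply/eqP/andP => [<- | [lemn /eqP ->]]; last by rewrite subnK.
by rewrite leq_addl addnK.
Qed.

Lemma sum_comp_rcons (V : nmodType) N n r (F : seq nat -> V) : (n < N)%N ->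
  \sum_(t : r.+1.-tuple 'I_N.+1 | is_comp n.+1 [seq val i | i <- t])
      F [seq val i | i <- t] =
  \sum_(j < n.+1)
    \sum_(t : r.-tuple 'I_N.+1 | is_comp (n - j) [seq val i | i <- t])
      F (rcons [seq val i | i <- t] j.+1).
Proof.
move=> ltnN.
pose h (u : 'I_N.+1 * r.-tuple 'I_N.+1) := [tuple of rcons u.2 u.1].
have h_bij : bijective h.
  apply: inj_card_bij => [[m t] [m' t'] /(congr1 val) /= /rcons_inj[] |].
    by move=> /val_inj-> ->.
  by rewrite card_prod !card_tuple expnS.
rewrite (reindex h) /=; last exact: onW_bij.
under eq_bigl => u do rewrite map_rcons is_comp_rcons andbA.
under eq_bigr => u _ do rewrite map_rcons.
rewrite -(pair_big_dep (fun m : 'I_N.+1 => (0 < m <= n.+1)%N)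
  (fun (m : 'I_N.+1) (t : r.-tuple _) =>
    is_comp (n.+1 - m) [seq val i | i <- t])
  (fun m (t : r.-tuple _) => F (rcons [seq val i | i <- t] (val m)))) /=.
rewrite big_mkcond big_ord_recl /= add0r -big_mkcond /=.
by rewrite (big_ord_widen N (fun j => \sum_(t : r.-tuple 'I_N.+1 |
  is_comp (n - j) [seq val i | i <- t]) F (rcons [seq val i | i <- t] j.+1))).
Qed.

Section NormalOrdering.
Variables (R : nzRingType) (a x : R) (N : nat).

Let xi i := iter i (ad a) x.

(* [xi j.-1] is the [x^{|> j}] of the statement.  The bound [N] on the parts
   is no restriction when [n <= N]; it gives all compositions occurring in an
   induction on [n] the same type. *)
Definition comp_ad r n (z : R) : R :=
  \sum_(t : r.-tuple 'I_N.+1 | is_comp n [seq val i | i <- t])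
    foldr (fun j => ad (xi j.-1)) z [seq val i | i <- t]
      *+ seq_comp_coef [seq val i | i <- t].

Lemma comp_ad_zmod_morphism r n : zmod_morphism (comp_ad r n).
Proof.
move=> y z; rewrite /comp_ad -sumrB; apply: eq_bigr => t _; rewrite -mulrnBl.
by congr (_ *+ _); elim: {t}[seq _ | _ <- _] => //= j s ->; rewrite raddfB.
Qed.

HB.instance Definition _ r n :=
  GRing.isZmodMorphism.Build R R (comp_ad r n) (comp_ad_zmod_morphism r n).

Lemma comp_ad0 n z : comp_ad 0 n z = if n == 0%N then z else 0.
Proof.
rewrite /comp_ad (eq_bigl (fun=> n == 0%N)) => [|t]; last first.
  by rewrite tuple0 /is_comp /= eq_sym.
case: (n == 0%N); last by rewrite big_pred0_eq.
rewrite (big_pred1 [tuple]) => [|t]; last by rewrite [t]tuple0.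
by rewrite /seq_comp_coef big_ord0.
Qed.

Lemma comp_adS0 r z : comp_ad r.+1 0 z = 0.
Proof.
apply: big_pred0 => t; apply/negbTE; rewrite /is_comp.
by case/tupleP: t => -[[|j] ltj] t /=; rewrite ?andbF.
Qed.

Lemma comp_adSS r n z : (n < N)%N ->
  comp_ad r.+1 n.+1 z =
  \sum_(j < n.+1) comp_ad r (n - j) (ad (xi j) z) *+ 'C(n, j).
Proof.
move=> ltnN; rewrite /comp_ad (sum_comp_rcons _
  (fun s => foldr (fun j => ad (xi j.-1)) z s *+ seq_comp_coef s)) //.
apply: eq_bigr => j _; rewrite -sumrMnl; apply: eq_bigr => t /andP[_ /eqP st].
rewrite foldr_rcons seq_comp_coef_rcons st mulrnA addnS /= subnK //.
by rewrite -ltnS.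
Qed.

(* Moving [ad a] to the right past [ad x_(s_1)], ..., [ad x_(s_r)] increases
   one part of [s] at a time; the term in [ad x] provides the compositions of
   [n + 1] whose first part is a new 1. *)
Lemma ad_comp_ad r n z : (n < N)%N ->
  ad a (comp_ad r n z) + (if r is r'.+1 then ad x (comp_ad r' n z) else 0) =
  comp_ad r n (ad a z) + comp_ad r n.+1 z.
Proof.
elim: r n z => [|r IHr] n z ltnN.
  by rewrite !comp_ad0 addr0 /= addr0; case: eqP => // _; rewrite raddf0.
case: n ltnN => [|n] ltnN.
  rewrite !comp_adS0 raddf0 !add0r comp_adSS // big_ord1 subn0 bin0 mulr1n.
  by case: r {IHr} => [|r]; rewrite ?comp_ad0 //= !comp_adS0 raddf0.
have ltnN' := ltnW ltnN.
have -> : ad x (comp_ad r n.+1 z) = \sum_(j < n.+1)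
    (if r is r'.+1 then ad x (comp_ad r' (n - j) (ad (xi j) z)) else 0)
      *+ 'C(n, j).
  case: r {IHr} => [|r].
    by rewrite comp_ad0 raddf0 big1 // => j _; rewrite mul0rn.
  rewrite comp_adSS // raddf_sum /=.
  by apply: eq_bigr => j _; rewrite raddfMn.
rewrite !comp_adSS //.
rewrite (sum_bin_pascal _ (fun j => comp_ad r (n.+1 - j) (ad (xi j) z))).
rewrite raddf_sum -!big_split; apply: eq_bigr => j _ /=.
rewrite raddfMn -!mulrnDl; congr (_ *+ _).
have lejn : (j <= n)%N by rewrite -ltnS.
rewrite IHr; last exact: leq_ltn_trans (leq_subr _ _) ltnN'.
by rewrite ad_jacobi raddfD /= subSS subSn // -addrA addrC -addrA.
Qed.

Lemma coef_iter_ad_affine n r : (n < N)%N ->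
  (iter n (ad (affine x a)) x%:P)`_r =
  \sum_(j < n.+1) comp_ad r (n - j) (xi j) *+ 'C(n, j).
Proof.
elim: n r => [|n IHn] r ltnN.
  rewrite big_ord1 subnn bin0 mulr1n coefC.
  by case: r => [|r]; rewrite ?comp_ad0 ?comp_adS0.
have ltnN' := ltnW ltnN; rewrite iterS coef_ad_affine.
have -> : (if r is r'.+1 then
    ad x (iter n (ad (affine x a)) x%:P)`_r' else 0) = \sum_(j < n.+1)
    (if r is r'.+1 then ad x (comp_ad r' (n - j) (xi j)) else 0) *+ 'C(n, j).
  case: r => [|r]; first by rewrite big1 // => j _; rewrite mul0rn.
  by rewrite IHn // raddf_sum; apply: eq_bigr => j _; rewrite raddfMn.
rewrite IHn // (sum_bin_pascal _ (fun j => comp_ad r (n.+1 - j) (xi j))).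
rewrite raddf_sum -!big_split; apply: eq_bigr => j _ /=.
rewrite raddfMn -!mulrnDl; congr (_ *+ _).
rewrite ad_comp_ad; last exact: leq_ltn_trans (leq_subr _ _) ltnN'.
by rewrite subSS subSn 1?addrC // -ltnS.
Qed.

End NormalOrdering.

Lemma coef_iter_ad_compositions (k : fieldType) (B : algType k) (a x : B) n r :
  (iter n (ad (affine x a)) x%:P)`_r =
  \sum_(t in compositions n.+1 r.+1) (comp_coef t)%:R *:
    nested_bracket (@ad B)
      [seq iter (i : 'I_n.+2).-1 (ad a) x | i <- t].
Proof.
rewrite (coef_iter_ad_affine _ _ _ (ltnSn n)).
under [RHS]eq_bigl => t do rewrite mem_compositions.
under [RHS]eq_bigr => t _.
  rewrite comp_coefE scaler_nat.
  rewrite -[[seq _ | _ <- _]]/(map ((fun i => iter i.-1 (ad a) x) \o val) t).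
  rewrite map_comp.
over.
rewrite (@sum_comp_rcons _ _ _ _ (fun s => nested_bracket (@ad B)
  [seq iter i.-1 (ad a) x | i <- s] *+ seq_comp_coef s)) //.
apply: eq_bigr => j _; rewrite -sumrMnl; apply: eq_bigr => t /andP[_ /eqP st].
rewrite seq_comp_coef_rcons st mulrnA addnS /= subnK; last by rewrite -ltnS.
congr (_ *+ _ *+ _); elim: {t st}[seq _ | _ <- _] => //= i s ->.
by case: s.
Qed.

Section Unitization.
Variables (k : fieldType) (A : lmodType k) (mul : A -> A -> A).
Variable mulP : assoc_algebra mul.

Lemma assoc_algebraDl x y z : mul (x + y) z = mul x z + mul y z.
Proof. by have := mulP.1.1 z 1 x y; rewrite /= !scale1r. Qed.

Lemma assoc_algebraDr x y z : mul x (y + z) = mul x y + mul x z.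
Proof. by have := mulP.1.2 x 1 y z; rewrite /= !scale1r. Qed.

Lemma assoc_algebra0l x : mul 0 x = 0.
Proof. by apply: (addrI (mul 0 x)); rewrite -assoc_algebraDl !addr0. Qed.

Lemma assoc_algebra0r x : mul x 0 = 0.
Proof. by apply: (addrI (mul x 0)); rewrite -assoc_algebraDr !addr0. Qed.

Lemma assoc_algebraZl c x y : mul (c *: x) y = c *: mul x y.
Proof. by have := mulP.1.1 y c x 0; rewrite /= assoc_algebra0l !addr0. Qed.

Lemma assoc_algebraZr c x y : mul x (c *: y) = c *: mul x y.
Proof. by have := mulP.1.2 x c y 0; rewrite /= assoc_algebra0r !addr0. Qed.

Definition unitization of assoc_algebra mul : Type := (k^o * A)%type.
Local Notation B := (unitization mulP).

HB.instance Definition _ := GRing.Lmodule.copy B (k^o * A)%type.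

Definition unitization_one : B := (1, 0).

Definition unitization_mul (u v : B) : B :=
  (u.1 * v.1, u.1 *: v.2 + v.1 *: u.2 + mul u.2 v.2).

Lemma unitization_mulA : associative unitization_mul.
Proof.
have [_ mulA] := mulP; move=> [a x] [b y] [c z].
congr (_, _); rewrite /= ?mulrA //.
rewrite !(assoc_algebraDl, assoc_algebraDr, assoc_algebraZl, assoc_algebraZr).
rewrite !scalerDr !scalerA mulA !addrA; congr (_ + _).
rewrite [c * a]mulrC [c * b]mulrC -!addrA; congr (_ + (_ + _)).
by rewrite addrCA; congr (_ + _); rewrite addrA addrC.
Qed.

Lemma unitization_mul1 : left_id unitization_one unitization_mul.
Proof.
by case=> a x; congr (_, _); rewrite /= ?mul1r // scale1r scaler0 addr0
  assoc_algebra0l addr0.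
Qed.

Lemma unitization_1mul : right_id unitization_one unitization_mul.
Proof.
by case=> a x; congr (_, _); rewrite /= ?mulr1 // scale1r scaler0 add0r
  assoc_algebra0r addr0.
Qed.

Lemma unitization_mulDl : left_distributive unitization_mul +%R.
Proof.
move=> [a x] [b y] [c z]; congr (_, _); rewrite /= ?mulrDl //.
rewrite assoc_algebraDl scalerDl scalerDr [RHS]addrACA.
by congr (_ + _); rewrite addrACA.
Qed.

Lemma unitization_mulDr : right_distributive unitization_mul +%R.
Proof.
move=> [a x] [b y] [c z]; congr (_, _); rewrite /= ?mulrDr //.
rewrite assoc_algebraDr scalerDl scalerDr [RHS]addrACA.
by congr (_ + _); rewrite addrACA.
Qed.

Lemma unitization_one_neq0 : unitization_one != 0.
Proof. by apply/eqP => -[] /eqP; rewrite oner_eq0. Qed.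

HB.instance Definition _ := GRing.Zmodule_isNzRing.Build B
  unitization_mulA unitization_mul1 unitization_1mul
  unitization_mulDl unitization_mulDr unitization_one_neq0.

Lemma unitization_scaleAl (c : k) (u v : B) : c *: (u * v) = c *: u * v.
Proof.
case: u v => [a x] [b y]; congr (_, _); rewrite /= ?scalerAl //.
by rewrite assoc_algebraZl !scalerDr !scalerA [c * b]mulrC.
Qed.

HB.instance Definition _ := GRing.Lmodule_isLalgebra.Build k B
  unitization_scaleAl.

Lemma unitization_scaleAr (c : k) (u v : B) : c *: (u * v) = u * (c *: v).
Proof.
case: u v => [a x] [b y]; congr (_, _); rewrite /= ?scalerAr //.
by rewrite assoc_algebraZr !scalerDr !scalerA [c * a]mulrC.
Qed.

HB.instance Definition _ := GRing.Lalgebra_isAlgebra.Build k B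
  unitization_scaleAr.

Definition to_unitization (x : A) : B := (0, x).

Lemma to_unitization_linear : linear to_unitization.
Proof. by move=> c x y; congr (_, _); rewrite /= scaler0 addr0. Qed.

HB.instance Definition _ :=
  GRing.isLinear.Build k A B *:%R to_unitization to_unitization_linear.

Lemma to_unitization_inj : injective to_unitization.
Proof. by move=> x y []. Qed.

Lemma to_unitizationM x y :
  to_unitization (mul x y) = to_unitization x * to_unitization y.
Proof. by congr (_, _); rewrite /= ?mul0r // !scale0r !add0r. Qed.

Lemma to_unitization_commutator x y :
  to_unitization (commutator mul x y) =
  ad (to_unitization x) (to_unitization y).
Proof. by rewrite raddfB /= !to_unitizationM. Qed.

Lemma to_unitization_pow n x : (0 < n)%N ->
  to_unitization (alg_pow mul n x) = to_unitization x ^+ n.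
Proof.
case: n => // n _; rewrite /alg_pow /=; elim: n => [|n IHn] //=.
by rewrite to_unitizationM IHn -exprS.
Qed.

End Unitization.

Section AdAlg.
Variables (k : fieldType) (B : algType k).

Lemma adZl c (x y : B) : ad (c *: x) y = c *: ad x y.
Proof. by rewrite /ad -scalerAl -scalerAr scalerBr. Qed.

Lemma adZr c (x y : B) : ad x (c *: y) = c *: ad x y.
Proof. by rewrite /ad -scalerAl -scalerAr scalerBr. Qed.

Lemma iter_adZ c n (x y : B) :
  iter n (fun z => c *: ad x z) y = c ^+ n *: iter n (ad x) y.
Proof.
by elim: n => [|n /= ->]; rewrite ?scale1r // adZr scalerA -exprS.
Qed.

End AdAlg.

#[local] Arguments tpoly_bracket : simpl never.

Section ScaledCommutator.
Variables (k : fieldType) (A : lmodType k) (mul : A -> A -> A).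
Variables (mulP : assoc_algebra mul) (lambda : k).

Let br x y := lambda *: commutator mul x y.
Local Notation iota := (to_unitization mulP).

Lemma to_unitization_br x y : iota (br x y) = lambda *: ad (iota x) (iota y).
Proof. by rewrite linearZ /= to_unitization_commutator. Qed.

Lemma to_unitization_iter n (f : A -> A) g x :
    (forall y, iota (f y) = g (iota y)) ->
  iota (iter n f x) = iter n g (iota x).
Proof. by move=> fg; elim: n => //= n <-. Qed.

Lemma to_unitization_iter_br n x y :
  iota (iter n (br x) y) = lambda ^+ n *: iter n (ad (iota x)) (iota y).
Proof.
rewrite -iter_adZ; apply: to_unitization_iter => z.
by rewrite to_unitization_br.
Qed.

Lemma lie_algebra_commutator : lie_algebra br.
Proof.
split.
- split=> x c y z /=; apply: (@to_unitization_inj _ _ _ mulP).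
    rewrite !(to_unitization_br, linearP) /= !to_unitization_br adDl adZl.
    by rewrite scalerDr !scalerA mulrC.
  rewrite !(to_unitization_br, linearP) /= !to_unitization_br adDr adZr.
  by rewrite scalerDr !scalerA mulrC.
- by move=> x; rewrite /br /commutator subrr scaler0.
- move=> x y z; apply: (@to_unitization_inj _ _ _ mulP).
  rewrite !raddfD raddf0 /= !to_unitization_br !adZr -!scalerDr ad_jacobi.
  rewrite [ad (iota z) (iota x)]adC [ad (iota z) (ad _ _)]adC raddfN /=.
  by rewrite addrK subrr !scaler0.
Qed.

Lemma tpoly_bracket_affine x y (u : nat -> A) i :
  tpoly_bracket br (tpoly_affine x y) u i =
  br y (u i) + (if i is j.+1 then br x (u j) else 0).
Proof.
rewrite /tpoly_bracket big_ord_recl subn0; congr (_ + _).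
case: i => [|i]; first by rewrite big_ord0.
rewrite big_ord_recl big1 ?addr0 ?subSS ?subn0 // => j _.
rewrite /br /commutator /= (assoc_algebra0l mulP) (assoc_algebra0r mulP).
by rewrite subrr scaler0.
Qed.

Lemma to_unitization_tpoly n x y i :
  iota (iter n (tpoly_bracket br (tpoly_affine x y)) (tpoly_const x) i) =
  lambda ^+ n *: (iter n (ad (affine (iota x) (iota y))) (iota x)%:P)`_i.
Proof.
elim: n i => [|n IHn] i.
  by rewrite scale1r coefC; case: i => //=; rewrite raddf0.
rewrite iterS [in RHS]iterS coef_ad_affine tpoly_bracket_affine.
rewrite [LHS]raddfD [RHS]scalerDr /= to_unitization_br IHn adZr scalerA -exprS.
congr (_ + _); case: i => [|i]; first by rewrite raddf0 scaler0.
by rewrite to_unitization_br IHn adZr scalerA -exprS.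
Qed.

Lemma to_unitization_nested_bracket (s : seq A) :
  iota (nested_bracket br s) =
  lambda ^+ (size s).-1 *: nested_bracket (@ad _) [seq iota x | x <- s].
Proof.
elim: s => [|x [|y s] IHs]; rewrite ?raddf0 ?scaler0 ?scale1r //.
rewrite -[nested_bracket br _]/(br x (nested_bracket br (y :: s))).
by rewrite to_unitization_br IHs adZr scalerA -exprS.
Qed.

Variables (p : nat) (hp : p \in [pchar k]).

Let pmap x := lambda ^+ p.-1 *: alg_pow mul p x.

Lemma to_unitization_pmap x : iota (pmap x) = lambda ^+ p.-1 *: iota x ^+ p.
Proof.
by rewrite linearZ /= to_unitization_pow // prime_gt0 // (pcharf_prime hp).
Qed.

Lemma restricted_lie_algebra_commutator : restricted_lie_algebra br p pmap.
Proof.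
have p_gt0 := prime_gt0 (pcharf_prime hp).
split; first exact: lie_algebra_commutator.
- move=> c x; apply: (@to_unitization_inj _ _ _ mulP).
  rewrite [RHS]linearZ /= !to_unitization_pmap [iota (_ *: _)]linearZ /=.
  by rewrite exprZn !scalerA mulrC.
- move=> x y; apply: (@to_unitization_inj _ _ _ mulP).
  rewrite to_unitization_br to_unitization_pmap to_unitization_iter_br.
  by rewrite adZl scalerA -exprS prednK // (ad_exp_pchar (pchar_algType _ hp)).
- move=> x y; apply: (@to_unitization_inj _ _ _ mulP).
  rewrite !raddfD raddf_sum /= !to_unitization_pmap raddfD /=.
  rewrite exp_add_pchar // !scalerDr scaler_sumr; congr (_ + _ + _).
  apply: eq_bigr => i _; rewrite [RHS]linearZ /= to_unitization_tpoly.
  by rewrite !scalerA mulrC.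
Qed.

End ScaledCommutator.

Section RotaBaxter.
Variables (k : fieldType) (A : lmodType k) (mul : A -> A -> A).
Variables (lambda : k) (P : A -> A).
Hypothesis hA : rota_baxter_algebra mul lambda P.

Let mulP := rba_assoc_algebra hA.
Local Notation iota := (to_unitization mulP).
Let br x y := lambda *: commutator mul x y.
Let tri x y := commutator mul (P x) y.

HB.instance Definition _ := GRing.isLinear.Build k A A *:%R P (rba_linear hA).

Lemma to_unitization_tri x y : iota (tri x y) = ad (iota (P x)) (iota y).
Proof. exact: to_unitization_commutator. Qed.

(* The bracket fed to [P] is the commutator of the product
   [P x * y + x * P y + lambda x * y], for which [P] is multiplicative. *)
Lemma rota_baxter_bracket x y :
  P (br x y + tri x y - tri y x) = commutator mul (P x) (P y).
Proof.
rewrite /commutator !(rba_identity hA) /br /tri /commutator.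
rewrite !(linearB, linearD, linearZ) /= opprK scalerN scalerBr.
rewrite [RHS]addrACA [RHS]addrC -[LHS]addrA; congr (_ + _).
by rewrite addrACA [RHS]addrACA; congr (_ + _); rewrite addrC.
Qed.

Lemma post_lie_algebra_rota_baxter : post_lie_algebra br tri.
Proof.
split; first exact: lie_algebra_commutator.
- split=> x c y z /=; apply: (@to_unitization_inj _ _ _ mulP).
    rewrite !(to_unitization_tri, linearP) /= !to_unitization_tri.
    by rewrite adDl adZl.
  rewrite !(to_unitization_tri, linearP) /= !to_unitization_tri.
  by rewrite adDr adZr.
- move=> x y z; apply: (@to_unitization_inj _ _ _ mulP).
  rewrite to_unitization_tri raddfD /= !to_unitization_br !to_unitization_tri.
  by rewrite adZr (ad_jacobi (iota (P x))) [LHS]scalerDr.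
- move=> x y z; rewrite {1}/tri rota_baxter_bracket.
  apply: (@to_unitization_inj _ _ _ mulP).
  rewrite [RHS]raddfB /= !to_unitization_tri !to_unitization_commutator.
  by rewrite (ad_jacobi (iota (P x))) addrK.
Qed.

(* The powers of [x] for the product [P x * y + x * P y + lambda x * y]. *)
Definition rb_pow n x : A :=
  iter n.-1 (fun y => mul (P x) y + mul x (P y) + lambda *: mul x y) x.

Lemma rota_baxter_pow n x : P (rb_pow n x) = alg_pow mul n (P x).
Proof.
rewrite /rb_pow /alg_pow; elim: n.-1 => //= m <-.
by rewrite (rba_identity hA) !linearD linearZ.
Qed.

Lemma to_unitization_rb_pow n x :
  iota (rb_pow n.+1 x) =
  \sum_(i < n.+1) (iota (P x) + lambda *: iota x) ^+ i * iota x
     * iota (P x) ^+ (n.+1 - i.+1).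
Proof.
elim: n => [|n IHn].
  by rewrite big_ord1 subnn !expr0 mul1r mulr1.
pose w := rb_pow n.+1 x; rewrite big_ord_recl expr0 mul1r subn1.
have -> : rb_pow n.+2 x = mul (P x) w + mul x (P w) + lambda *: mul x w by [].
rewrite rota_baxter_pow addrAC !(linearD (to_unitization mulP)) linearZ /=.
rewrite !to_unitizationM to_unitization_pow // [LHS]addrC; congr (_ + _).
rewrite [lambda *: (_ * _)]scalerAl -[LHS]mulrDl IHn mulr_sumr.
by apply: eq_bigr => i _; rewrite /bump /= add1n exprS !mulrA subSS.
Qed.

Lemma double_pmap_rota_baxter n (hp : n.+1 \in [pchar k]) x :
  double_pmap n.+1 br (fun y => lambda ^+ n *: alg_pow mul n.+1 y) tri x =
  rb_pow n.+1 x.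
Proof.
apply: (@to_unitization_inj _ _ _ mulP).
rewrite to_unitization_rb_pow sum_exp_affine raddfD /=.
rewrite (to_unitization_pmap mulP lambda hp) big_ord_recr /=.
rewrite coef_exp_affine_top addrC; congr (_ + _).
rewrite raddf_sum /= big_add1 big_mkord; apply: eq_bigr => r _.
rewrite (coef_exp_affine_div hp); last exact: (ltn_ord r).
rewrite [LHS]linearZ /= [RHS]scalerA mulrC -[RHS]scalerA; congr (_ *: _).
rewrite coef_iter_ad_compositions raddf_sum scaler_sumr.
apply: eq_bigr => t _; rewrite [LHS]linearZ /= [RHS]scalerA mulrC -[RHS]scalerA.
congr (_ *: _); rewrite to_unitization_nested_bracket size_map size_tuple.
congr (_ *: nested_bracket _ _); rewrite -map_comp; apply: eq_map => i /=.
by apply: to_unitization_iter => y; rewrite to_unitization_tri.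
Qed.

End RotaBaxter.

Theorem corollary4p15 (k : closedFieldType) (p : nat) (hp : p \in [pchar k])
    (A : lmodType k) (mul : A -> A -> A) (lambda : k) (P : A -> A)
    (hA : rota_baxter_algebra mul lambda P) :
  restricted_post_lie_algebra p
    (fun x y : A => lambda *: commutator mul x y)
    (fun x : A => lambda ^+ p.-1 *: alg_pow mul p x)
    (fun x y : A => commutator mul (P x) y).
Proof.
have p_gt0 := prime_gt0 (pcharf_prime hp).
have mulP := rba_assoc_algebra hA.
split.
- exact: post_lie_algebra_rota_baxter.
- exact: restricted_lie_algebra_commutator.
- move=> x y; apply: (@to_unitization_inj _ _ _ mulP).
  rewrite to_unitization_commutator (to_unitization_pmap mulP lambda hp).
  rewrite (to_unitization_iter_br mulP) to_unitization_commutator adZr.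
  congr (_ *: _); rewrite adC (ad_exp_pchar (pchar_algType _ hp)).
  by rewrite -[in LHS](prednK p_gt0) iterSr [ad _ _]adC iter_adN opprK.
case: p hp p_gt0 => // n hp _ x y.
rewrite double_pmap_rota_baxter // rota_baxter_pow //.
apply: (@to_unitization_inj _ _ _ mulP).
rewrite to_unitization_commutator to_unitization_pow //.
rewrite (ad_exp_pchar (pchar_algType _ hp)).
symmetry; apply: to_unitization_iter => z.
exact: to_unitization_commutator.
Qed.
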